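(* Let $d\ge2$, let $H\in\mathbb S_{++}^d$, and let $\mathfrak F\subset\mathbb S_{++}^d$ be nonempty and closed under positive rescaling ($G\in\mathfrak F$, $c>0$ imply $cG\in\mathfrak F$). Define $$K_{\mathfrak F}^\star(H)=\inf_{G\in\mathfrak F}\kappa(G^{-1}H),\qquad \delta_{\mathfrak F}(H)=d_{\mathrm{AI}}(H,\mathfrak F)=\inf_{G\in\mathfrak F}d_{\mathrm{AI}}(H,G),\qquad \alpha_d=\sqrt{\frac{d}{\lfloor d^2/4\rfloor}}.$$ Then $$\log K_{\mathfrak F}^\star(H)\ge\alpha_d\,\delta_{\mathfrak F}(H),\qquad\text{i.e.}\qquad K_{\mathfrak F}^\star(H)\ge\exp\{\alpha_d\,d_{\mathrm{AI}}(H,\mathfrak F)\}.$$ The constant $\alpha_d$ is sharp over general scale-closed families: for each $d\ge2$ it cannot be replaced by any larger constant for which the inequality holds for all nonempty scale-closed $\mathfrak F\subset\mathbb S_{++}^d$ and all $H\in\mathbb S_{++}^d$.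
   Context: $\mathbb S_{++}^d$ denotes real symmetric positive-definite $d\times d$ matrices, $d_{\mathrm{AI}}(G_0,G_1)=\|\log(G_0^{-1/2}G_1G_0^{-1/2})\|_F$ is the affine-invariant distance, and $\kappa(G^{-1}H)$ is the ratio of the largest to the smallest generalized eigenvalue in $Hv=\lambda Gv$. *)

(* Defs.v *)
From HB Require Import structures.
From mathcomp Require Import all_boot all_order all_algebra.
From mathcomp Require Import all_classical all_reals all_analysis.

Set Implicit Arguments.
Unset Strict Implicit.
Unset Printing Implicit Defensive.

Import Order.TTheory GRing.Theory Num.Theory.
Local Open Scope classical_set_scope.
Local Open Scope ring_scope.

Definition spd (R : realType) (d : nat) : set 'M[R]_d :=
  [set A | A^T = A /\
    forall v : 'cV[R]_d, v != 0 -> 0 < (v^T *m A *m v) 0 0].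

(* Functional calculus: [f (P^T diag(D) P) = P^T diag(f D) P] for P orthogonal.
   On a symmetric matrix such a P exists (spectral theorem) and the result does
   not depend on P and D, so the choice made by [xget] is immaterial there;
   the value is 0 on non-symmetric matrices. *)
Definition mxfun (R : realType) (d : nat) (f : R -> R) (A : 'M[R]_d) :
    'M[R]_d :=
  xget 0 [set B | exists (P : 'M[R]_d) (D : 'rV[R]_d),
    [/\ P *m P^T = 1%:M,
        A = P^T *m diag_mx D *m P
      & B = P^T *m diag_mx (map_mx f D) *m P]].

Definition mxsqrt (R : realType) (d : nat) (A : 'M[R]_d) : 'M[R]_d :=
  mxfun Num.sqrt A.

Definition mxlog (R : realType) (d : nat) (A : 'M[R]_d) : 'M[R]_d :=
  mxfun (@ln R) A.

(* The library norm [`|A|] on matrices is the max norm. *)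
Definition frobenius (R : realType) (d : nat) (A : 'M[R]_d) : R :=
  Num.sqrt (\sum_(i < d) \sum_(j < d) A i j ^+ 2).

Definition dAI (R : realType) (d : nat) (G0 G1 : 'M[R]_d) : R :=
  frobenius (mxlog (invmx (mxsqrt G0) *m G1 *m invmx (mxsqrt G0))).

Definition gen_eigenvalues (R : realType) (d : nat) (G H : 'M[R]_d) : set R :=
  [set l | exists2 v : 'cV[R]_d, v != 0 & H *m v = l *: (G *m v)].

(* [kappa G H] is kappa(G^-1 H). For positive-definite G, H and 0 < d, the set
   of generalized eigenvalues is finite and nonempty, so that [sup] and [inf]
   are its largest and smallest elements. *)
Definition kappa (R : realType) (d : nat) (G H : 'M[R]_d) : R :=
  sup (gen_eigenvalues G H) / inf (gen_eigenvalues G H).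

Definition scale_closed (R : realType) (d : nat) (F : set 'M[R]_d) : Prop :=
  forall (G : 'M[R]_d) (c : R), F G -> 0 < c -> F (c *: G).

Definition scale_family (R : realType) (d : nat) (F : set 'M[R]_d) : Prop :=
  [/\ F `<=` @spd R d, F !=set0 & scale_closed F].

Definition Kstar (R : realType) (d : nat) (F : set 'M[R]_d) (H : 'M[R]_d) : R :=
  inf [set kappa G H | G in F].

Definition deltaAI (R : realType) (d : nat) (F : set 'M[R]_d) (H : 'M[R]_d) : R :=
  inf [set dAI H G | G in F].

Definition alpha (R : realType) (d : nat) : R :=
  Num.sqrt (d%:R / (d ^ 2 %/ 4)%N%:R).

(* Main.v *)
Require Import Defs.
From HB Require Import structures.
From mathcomp Require Import all_boot all_order all_algebra.
From mathcomp Require Import all_classical all_reals all_analysis.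
From mathcomp Require Import complex.
From mathcomp Require Import ring lra zify.

Set Implicit Arguments.
Unset Strict Implicit.
Unset Printing Implicit Defensive.

Import Order.TTheory GRing.Theory Num.Theory.
Local Open Scope classical_set_scope.
Local Open Scope ring_scope.

(** Let [m] list, with multiplicity, the eigenvalues of H^-1/2 G H^-1/2, and put
    x_i = ln m_i.  Then d_AI(H,G) is the Euclidean norm of x, whereas
    ln kappa(G^-1 H) = max x - min x, because the generalized eigenvalues of
    (G, H) are the 1/m_i.  Replacing G by c G translates all x_i by ln c; this
    leaves kappa unchanged, and choosing ln c = - mean x makes the distance
    equal to the square root of sum (x_i - mean x)^2 ([dAI_scale_spread]).

    The comparison of the two quantities is thus an inequality between the
    variance and the range of d real numbers: d times the sum of the squared
    deviations is at most floor(d^2/4) times the squared range ([spread_le]).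
    Indeed that expression is convex in each x_i, so over a cube it is largest
    at a vertex; at a vertex with k coordinates at the top and d - k at the
    bottom it equals k(d-k) times the squared range, and
    k(d-k) <= floor(d^2/4).  Taking square roots gives
    alpha_d d_AI(H, cG) <= ln kappa(G^-1 H) for a suitable c
    ([alpha_dAI_le_ln_kappa]), and since cG lies in the family, the infimum over
    G yields the lower bound.

    For sharpness ([alpha_sharp]) the extremal vertex is realised by H = 1 and
    the ray through the diagonal matrix with floor(d/2) entries e and the other
    entries 1: kappa is e along the whole ray, and the distance of the ray to
    the identity is exactly 1/alpha_d.

    The reduction rests on the spectral theorem for real symmetric matrices
    ([symmetric_spectral]) and on the independence of the functional calculus
    from the chosen diagonalisation ([mxfun_spectral]). *)

(** * Spectral theorem for real symmetric matrices *)

(** Over the complex numbers [A] is Hermitian, so its unitary diagonalisation has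
    real entries; an eigenvalue that lies in the base field is already one over
    that field. *)
Lemma symmetric_eigenvalue (R : rcfType) (n : nat) (A : 'M[R]_n.+1) :
  A^T = A -> exists a, eigenvalue A a.
Proof.
move=> symA; pose f := real_complex R; pose B := map_mx f A.
have Bherm : B \is hermsymmx.
  apply: realsym_hermsym.
    apply/is_hermitianmxP; rewrite expr0 scale1r; apply/matrixP => i j.
    by rewrite !mxE -{1}symA mxE.
  by apply/mxOverP => i j; rewrite mxE; apply/complex_realP; exists (A i j).
have /mxOverP/(_ 0 0)/complex_realP[a a_eq] := hermitian_spectral_diag_real Bherm.
exists a; rewrite -(eigenvalue_map f) -/B.
have /hermitian_normalmx/orthomx_spectralP B_eq := Bherm.
set P := spectralmx B in B_eq.
have Punit : P \in unitmx by apply: spectral_unit.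
apply/eigenvalueP; exists (row 0 P).
  rewrite -row_mul {1}B_eq !mulmxA mulmxV // mul1mx row_mul row_diag_mx.
  by rewrite a_eq -scalemxAl -rowE.
apply/negP => /eqP row0.
have := mulmxV Punit => /(congr1 (row 0)); rewrite row_mul row0 mul0mx.
move=> /matrixP/(_ 0 0); rewrite !mxE eqxx => /esym/eqP.
by rewrite oner_eq0.
Qed.

Lemma sqnorm_row (R : realFieldType) (n : nat) (v : 'rV[R]_n) :
  (v *m v^T) 0 0 = \sum_j v 0 j ^+ 2.
Proof. by rewrite mxE; apply: eq_bigr => j _; rewrite mxE expr2. Qed.

Lemma sqnorm_gt0 (R : realFieldType) (n : nat) (v : 'rV[R]_n) :
  v != 0 -> 0 < (v *m v^T) 0 0.
Proof.
move=> v0; rewrite lt_def sqnorm_row sumr_ge0 ?andbT; last first.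
  by move=> i _; apply: sqr_ge0.
apply: contra v0 => /eqP s0; apply/eqP/rowP => j; rewrite mxE.
have/psumr_eq0P/(_ s0 j isT)/eqP : forall j, true -> 0 <= v 0 j ^+ 2.
  by move=> k _; apply: sqr_ge0.
by rewrite sqrf_eq0 => /eqP.
Qed.

(** The witness is the Householder reflection exchanging the first basis vector
    and [v]; this is the orthonormal completion needed to deflate an
    eigenvector. *)
Lemma orthogonal_first_row (R : realFieldType) (n : nat) (v : 'rV[R]_n.+1) :
  v *m v^T = 1%:M -> exists2 Q : 'M[R]_n.+1, Q *m Q^T = 1%:M & row 0 Q = v.
Proof.
move=> v1; have [->|ve] := eqVneq v 'e_0.
  by exists 1%:M; rewrite ?trmx1 ?mulmx1 // row1.
pose u := v - 'e_0; have u0 : u != 0 by rewrite subr_eq0.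
pose s := (u *m u^T) 0 0; have s_gt0 : 0 < s by apply: sqnorm_gt0.
have uu : u *m u^T = s%:M by apply: mx11_scalar.
have e1 : ('e_0 : 'rV[R]_n.+1) *m ('e_0)^T = 1%:M.
  by rewrite -rowE; apply/matrixP => i j; rewrite !ord1 !mxE !eqxx.
have ev : 'e_0 *m v^T = (v 0 0)%:M.
  by rewrite -rowE; apply/matrixP => i j; rewrite !ord1 !mxE.
have ve' : v *m ('e_0)^T = (v 0 0)%:M.
  by rewrite -[LHS]trmxK trmx_mul trmxK ev tr_scalar_mx.
have sE : s = 2 - 2 * v 0 0.
  rewrite /s /u linearB /= mulmxBl !mulmxBr v1 e1 ev ve' !mxE !eqxx !mulr1n.
  by ring.
pose Q := 1%:M - (2 / s) *: (u^T *m u).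
have QT : Q^T = Q by rewrite /Q linearB /= trmx1 linearZ /= trmx_mul trmxK.
exists Q.
  have : (u^T *m u) *m (u^T *m u) = s *: (u^T *m u).
    by rewrite mulmxA -(mulmxA u^T) uu mul_mx_scalar -scalemxAl.
  rewrite QT /Q; move: (u^T *m u) => W WW.
  rewrite mulmxBl !mulmxBr !mulmx1 mul1mx -scalemxAl -scalemxAr WW.
  by apply/matrixP => i j; rewrite !mxE; field; rewrite gt_eqF.
rewrite rowE mulmxBr mulmx1 -scalemxAr mulmxA.
have -> : 'e_0 *m u^T = (v 0 0 - 1)%:M.
  by rewrite /u linearB /= mulmxBr ev e1 -scalar_mx_is_additive.
rewrite mul_scalar_mx scalerA.
have -> : 2 / s * (v 0 0 - 1) = -1.
  by apply: (mulIf (lt0r_neq0 s_gt0)); rewrite mulrAC divfK ?gt_eqF // sE; ring.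
by rewrite scaleN1r opprK /u addrC subrK.
Qed.

(** Deflation: conjugating by an orthogonal matrix whose first row is a unit
    eigenvector makes the first row, hence by symmetry the first column, vanish
    off the diagonal, and the induction hypothesis applies to the remaining
    block. *)
Theorem symmetric_spectral (R : rcfType) (n : nat) (A : 'M[R]_n) :
  A^T = A -> exists (P : 'M[R]_n) (D : 'rV[R]_n),
    P *m P^T = 1%:M /\ A = P^T *m diag_mx D *m P.
Proof.
elim: n A => [|n IH] A symA.
  by exists 1%:M, 0; split; apply/matrixP => -[].
have [a /eigenvalueP[w wA w0]] := symmetric_eigenvalue symA.
pose v := (Num.sqrt ((w *m w^T) 0 0))^-1 *: w.
have vA : v *m A = a *: v by rewrite -scalemxAl wA scalerA mulrC -scalerA.
have vv : v *m v^T = 1%:M.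
  rewrite linearZ /= -scalemxAl -scalemxAr scalerA.
  have w_gt0 := sqnorm_gt0 w0; rewrite {3}[w *m _]mx11_scalar.
  rewrite scale_scalar_mx -expr2 exprVn sqr_sqrtr ?ltW // mulVf //.
  by rewrite gt_eqF.
have [Q QQ Qv] := orthogonal_first_row vv.
have QQ' : Q^T *m Q = 1%:M by apply: mulmx1C.
pose B := (Q *m A *m Q^T : 'M[R]_(1 + n)).
have BQ : B = Q *m A *m Q^T by [].
clearbody B.
have symB : B^T = B by rewrite BQ !trmx_mul trmxK symA mulmxA.
have rowB : row 0 B = a *: 'e_0.
  by rewrite BQ !row_mul Qv vA -scalemxAl -Qv -row_mul QQ row1.
have B0 (i j : 'I_(1 + n)) : i = 0%N :> nat -> B i j = a * (j == 0%N :> nat)%:R.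
  move=> i0; have -> : i = 0 by apply: val_inj.
  by have /rowP/(_ j) := rowB; rewrite !mxE eqxx.
have Bul : ulsubmx B = a%:M.
  by apply/matrixP => i j; rewrite !ord1 !mxE B0 //= mulr1.
have Bur : ursubmx B = 0.
  by apply/matrixP => i j; rewrite !ord1 !mxE B0 //= mulr0.
have Bdl : dlsubmx B = 0 by rewrite -symB -trmx_ursub Bur trmx0.
have [P' [D' [PP' BE]]] := IH (drsubmx B) (etrans (trmx_drsub B) (congr1 _ symB)).
pose P := block_mx (1%:M : 'M[R]_1) 0 0 P'.
have PP : P *m P^T = 1%:M.
  rewrite /P tr_block_mx !trmx0 trmx1 mulmx_block !mulmx0 !mul0mx !addr0 !add0r.
  by rewrite PP' mulmx1 -scalar_mx_block.
exists (P *m Q : 'M[R]_(1 + n)), (row_mx (a%:M : 'rV[R]_1) D'); split.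
  by rewrite trmx_mul mulmxA -(mulmxA P) QQ mulmx1.
have BE2 : B = P^T *m diag_mx (row_mx (a%:M : 'rV[R]_1) D') *m P.
  rewrite -[B]submxK Bul Bur Bdl BE diag_mx_row /P tr_block_mx !mulmx_block.
  rewrite !trmx0 trmx1 !mulmx0 !mul0mx !addr0 !add0r mul1mx mulmx1 !mul0mx.
  congr block_mx; apply/matrixP => i j; rewrite !ord1 !mxE //.
rewrite trmx_mul -!mulmxA (mulmxA P^T) (mulmxA (P^T *m _)) -BE2 BQ.
by rewrite !mulmxA QQ' mul1mx -mulmxA QQ' mulmx1.
Qed.

(** * Discrete variance inequality *)

(** The left-hand side is convex in every [y i], so moving each coordinate in
    turn to a suitable end, 0 or [r], does not decrease it.  The offset [A]
    absorbs the coordinates still to be moved, which makes the induction on [n]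
    go through; [c] stays fixed because it will be the full dimension. *)
Lemma quadratic_vertex (R : realFieldType) (c r : R) (n : nat) (y : 'I_n -> R) :
  1 <= c -> (forall i, 0 <= y i <= r) -> forall A : R,
  exists2 k : nat, (k <= n)%N &
    c * (\sum_i y i ^+ 2) - (A + \sum_i y i) ^+ 2 <=
    c * (k%:R * r ^+ 2) - (A + k%:R * r) ^+ 2.
Proof.
move=> c1; elim: n y => [|n IH] y y01 A.
  by exists 0%N => //; rewrite !big_ord0 !mul0r.
rewrite !big_ord_recr /=; set t := y ord_max.
have /andP[t0 tr] : 0 <= t <= r := y01 ord_max.
have [k kn IHk] := IH (fun i => y (widen_ord (leqnSn n) i)) (fun i => y01 _) (A + t).
move: IHk; set S2 := \sum_(i < n) _; set S1 := \sum_(i < n) _ => IHk.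
pose B := A + k%:R * r.
(* bounding [t ^+ 2] by [t * r] replaces the convex parabola by its chord *)
have peel : c * (S2 + t ^+ 2) - (A + (S1 + t)) ^+ 2 <=
    c * (k%:R * r ^+ 2) + t * ((c - 1) * r - 2 * B) - B ^+ 2.
  have sq : (c - 1) * t ^+ 2 <= (c - 1) * (t * r).
    by rewrite ler_wpM2l ?subr_ge0 // expr2 ler_wpM2l.
  by move: IHk sq; rewrite /B; nra.
have [up|down] := leP 0 ((c - 1) * r - 2 * B).
  exists k.+1 => //; apply: le_trans peel _.
  have : t * ((c - 1) * r - 2 * B) <= r * ((c - 1) * r - 2 * B).
    by rewrite ler_wpM2r.
  by rewrite -natr1 /B; nra.
exists k; first exact: leqW.
apply: le_trans peel _.
have : t * ((c - 1) * r - 2 * B) <= 0 by rewrite mulr_ge0_le0 // ltW.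
by rewrite /B; nra.
Qed.

(** The square of [d] times the variance of [x]. *)
Definition spread (R : realFieldType) (d : nat) (x : 'I_d -> R) : R :=
  d%:R * (\sum_i x i ^+ 2) - (\sum_i x i) ^+ 2.

(** Steiner's identity multiplied by [d]: the sum of squares of a translate is
    minimal, equal to [spread x / d], when the translate is centred. *)
Lemma spread_shift (R : realFieldType) (d : nat) (x : 'I_d -> R) (t : R) :
  d%:R * (\sum_i (t + x i) ^+ 2) = spread x + (d%:R * t + \sum_i x i) ^+ 2.
Proof.
have -> : \sum_i (t + x i) ^+ 2 =
    d%:R * t ^+ 2 + 2 * t * (\sum_i x i) + \sum_i x i ^+ 2.
  rewrite (eq_bigr (fun i => t ^+ 2 + 2 * t * x i + x i ^+ 2)); last first.
    by move=> i _; ring.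
  rewrite !big_split /= sumr_const card_ord -mulr_sumr -[_ *+ d]mulr_natl; ring.
by rewrite /spread; ring.
Qed.

Lemma vertex_spread_le (d k : nat) :
  (k <= d)%N -> (d * k <= d ^ 2 %/ 4 + k ^ 2)%N.
Proof.
move=> /subnKC <-; move: (d - k)%N => e.
have AGM : (e * k <= (k + e) ^ 2 %/ 4)%N.
  by rewrite leq_divRL // mulnC addnC nat_AGM2.
by rewrite mulnDl addnC leq_add2r.
Qed.

(** Popoviciu's inequality in its sharp form for [d] points. *)
Lemma spread_le (R : realFieldType) (d : nat) (x : 'I_d -> R) (r : R) :
  (forall i j, x i - x j <= r) -> spread x <= (d ^ 2 %/ 4)%N%:R * r ^+ 2.
Proof.
case: d x => [|d] x xr.
  by rewrite /spread !big_ord0 mulr0 expr0n subr0 mulr_ge0 ?ler0n ?sqr_ge0.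
case: (arg_minP x (i0 := ord0) (P := predT)) => // i0 _ min_i0.
pose y i := - x i0 + x i.
have yr i : 0 <= y i <= r by rewrite /y addrC subr_ge0 min_i0 //= xr.
have := quadratic_vertex (c := d.+1%:R) _ yr 0; rewrite ler1n.
case=> // k kd; rewrite !add0r /y spread_shift => le_k.
have -> : spread x = d.+1%:R * (\sum_i y i ^+ 2) - (\sum_i y i) ^+ 2.
  rewrite spread_shift [\sum_i y i]big_split /= sumr_const card_ord -mulr_natl.
  by ring.
rewrite spread_shift; apply: le_trans le_k _.
have := vertex_spread_le kd; rewrite -(ler_nat R) natrM natrD natrX => le_nat.
have := sqr_ge0 r; nra.
Qed.

Lemma sum_half (R : pzRingType) (d : nat) :
  \sum_(i < d) ((i < d./2)%N%:R : R) = d./2%:R.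
Proof.
have half_le : (d./2 <= d)%N by rewrite leq_half_double -addnn -addnS leq_addr.
rewrite (eq_bigr (fun i : 'I_d => if (i < d./2)%N then 1 else 0 : R)).
  have <- : \sum_(i < d./2) (1 : R) = d./2%:R by rewrite sumr_const card_ord.
  by rewrite -big_mkcond big_ord_narrow.
by move=> i _; case: ifP.
Qed.

(** Equality in [spread_le] for a balanced two-valued family. *)
Lemma spread_split (R : realFieldType) (d : nat) :
  spread (fun i : 'I_d => (i < d./2)%N%:R : R) = (d ^ 2 %/ 4)%N%:R.
Proof.
rewrite /spread (eq_bigr (fun i : 'I_d => (i < d./2)%N%:R : R)); last first.
  by move=> i _; case: (_ < _)%N; rewrite ?expr1n ?expr0n.
rewrite sum_half.
have : (d * d./2 = d ^ 2 %/ 4 + d./2 ^ 2)%N by nia.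
by move=> /(congr1 (fun n => n%:R : R)); rewrite natrM natrD natrX => ->; rewrite addrK.
Qed.

(** * Functional calculus *)

(** Two orthogonal diagonalisations of one matrix differ by an orthogonal [U]
    intertwining the diagonals.  Entrywise, [U i j] vanishes unless the two
    corresponding eigenvalues agree, so [U] also intertwines their images under
    [f]. *)
Lemma mxfun_spectral (R : realType) (d : nat) (f : R -> R) (P : 'M[R]_d)
    (D : 'rV[R]_d) :
  P *m P^T = 1%:M ->
  mxfun f (P^T *m diag_mx D *m P) = P^T *m diag_mx (map_mx f D) *m P.
Proof.
move=> PP; apply: xget_subset1; first by exists P, D.
have PP' : P^T *m P = 1%:M by apply: mulmx1C.
suff uniq (Q : 'M[R]_d) (E : 'rV[R]_d) : Q *m Q^T = 1%:M ->
    P^T *m diag_mx D *m P = Q^T *m diag_mx E *m Q ->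
    P^T *m diag_mx (map_mx f D) *m P = Q^T *m diag_mx (map_mx f E) *m Q.
  by move=> B C [Q [E [QQ e ->]]] [Q' [E' [QQ' e' ->]]]; rewrite -!uniq.
move=> QQ e; have QQ' : Q^T *m Q = 1%:M by apply: mulmx1C.
pose U := Q *m P^T.
have UE : U *m diag_mx D = diag_mx E *m U.
  have := congr1 (fun X => Q *m X *m P^T) e.
  by rewrite /U !mulmxA QQ mul1mx -!mulmxA PP mulmx1.
have UfE : U *m diag_mx (map_mx f D) = diag_mx (map_mx f E) *m U.
  clearbody U; apply/matrixP => i j; move/matrixP/(_ i j): UE.
  rewrite !mul_mx_diag !mul_diag_mx !mxE.
  have [->|U0] := eqVneq (U i j) 0; first by rewrite !(mul0r, mulr0).
  rewrite [RHS]mulrC => DE; rewrite [RHS]mulrC.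
  by rewrite (mulfI U0 DE).
have := congr1 (fun X => Q^T *m X *m P) UfE.
by rewrite /U !mulmxA QQ' mul1mx -!mulmxA PP' mulmx1.
Qed.

Lemma frobenius_spectral (R : realType) (d : nat) (P : 'M[R]_d) (D : 'rV[R]_d) :
  P *m P^T = 1%:M ->
  frobenius (P^T *m diag_mx D *m P) = Num.sqrt (\sum_i D 0 i ^+ 2).
Proof.
move=> PP; congr Num.sqrt.
have trE (A : 'M[R]_d) : \sum_(i < d) \sum_(j < d) A i j ^+ 2 = \tr (A *m A^T).
  apply: eq_bigr => i _; rewrite mxE; apply: eq_bigr => j _.
  by rewrite mxE expr2.
rewrite trE !trmx_mul trmxK tr_diag_mx -!mulmxA (mulmxA P P^T) PP mul1mx.
rewrite mxtrace_mulC -!mulmxA PP mulmx1 mulmx_diag mxtrace_diag.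
by apply: eq_bigr => i _; rewrite !mxE expr2.
Qed.

Lemma spd_unitmx (R : realType) (d : nat) (A : 'M[R]_d) : spd A -> A \in unitmx.
Proof.
case=> _ posA; rewrite unitmxE unitfE; apply/det0P => -[v v0 vA].
have := posA v^T; rewrite trmxK trmx_eq0 => /(_ v0).
by rewrite vA mul0mx mxE ltxx.
Qed.

Lemma spd_congruence (R : realType) (d : nat) (S A : 'M[R]_d) :
  S \in unitmx -> spd A -> spd (S^T *m A *m S).
Proof.
move=> Sunit [symA posA]; split.
  by rewrite !trmx_mul trmxK symA mulmxA.
move=> v v0; have := posA (S *m v); rewrite trmx_mul !mulmxA; apply.
by apply: contra v0 => /eqP Sv; rewrite -[v](mulKmx Sunit) Sv mulmx0.
Qed.

Lemma spd_scale (R : realType) (d : nat) (c : R) (A : 'M[R]_d) :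
  0 < c -> spd A -> spd (c *: A).
Proof.
move=> c_gt0 [symA posA]; split; first by rewrite linearZ /= symA.
by move=> v v0; rewrite -scalemxAr -scalemxAl mxE mulr_gt0 // posA.
Qed.

Lemma spd_diag (R : realType) (d : nat) (D : 'rV[R]_d) :
  spd (diag_mx D) <-> forall i, 0 < D 0 i.
Proof.
split=> [[_ posD] i|D_gt0].
  have := posD (delta_mx i 0); rewrite trmx_delta -rowE row_diag_mx.
  rewrite -scalemxAl -rowE !mxE !eqxx mulr1; apply.
  by apply/eqP => /matrixP/(_ i 0)/eqP; rewrite !mxE !eqxx oner_eq0.
split; first by rewrite tr_diag_mx.
move=> v v0; rewrite mul_mx_diag mxE lt_def.
have ge0 i : true -> 0 <= (\matrix_(i, j) (v^T i j * D 0 j)) 0 i * v i 0.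
  by move=> _; rewrite !mxE mulrAC -expr2 mulr_ge0 ?sqr_ge0 // ltW.
rewrite sumr_ge0 // andbT; apply: contra v0 => /eqP s0; apply/eqP/colP => i.
have /(_ i isT)/eqP := psumr_eq0P ge0 s0.
by rewrite !mxE mulrAC -expr2 mulf_eq0 (gt_eqF (D_gt0 i)) orbF sqrf_eq0 => /eqP.
Qed.

Lemma spd_spectral (R : realType) (d : nat) (A : 'M[R]_d) :
  spd A -> exists (P : 'M[R]_d) (D : 'rV[R]_d),
    [/\ P *m P^T = 1%:M, A = P^T *m diag_mx D *m P & forall i, 0 < D 0 i].
Proof.
move=> spdA; have [P [D [PP AE]]] := symmetric_spectral spdA.1.
exists P, D; split=> //; apply/spd_diag.
have -> : diag_mx D = P^T^T *m A *m P^T.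
  by rewrite AE trmxK !mulmxA PP mul1mx -mulmxA PP mulmx1.
by apply: spd_congruence => //; rewrite unitmx_tr; case: (mulmx1_unit PP).
Qed.

Lemma mxsqrtP (R : realType) (d : nat) (A : 'M[R]_d) :
  spd A -> [/\ (mxsqrt A)^T = mxsqrt A, mxsqrt A *m mxsqrt A = A &
    mxsqrt A \in unitmx].
Proof.
move=> spdA; have [P [D [PP AE D_gt0]]] := spd_spectral spdA.
have PP' : P^T *m P = 1%:M by apply: mulmx1C.
pose E := map_mx Num.sqrt D.
have SE : mxsqrt A = P^T *m diag_mx E *m P by rewrite /mxsqrt AE mxfun_spectral.
have SS : mxsqrt A *m mxsqrt A = A.
  rewrite SE -!mulmxA (mulmxA P) PP mul1mx (mulmxA (diag_mx E)) mulmx_diag AE.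
  rewrite -mulmxA; congr (_ *m (diag_mx _ *m _)); apply/rowP => i.
  by rewrite !mxE -expr2 sqr_sqrtr // ltW.
split=> //; first by rewrite SE !trmx_mul trmxK tr_diag_mx mulmxA.
by have := spd_unitmx spdA; rewrite -{1}SS unitmx_mul => /andP[].
Qed.

(** * The relative spectrum of two metrics *)

(** The eigenvalues of H^-1 G, as a row so that multiplicities are kept: the
    distance depends on them, whereas [gen_eigenvalues] is only a set. *)
Definition relative_spectrum (R : realType) (d : nat) (H G : 'M[R]_d)
    (m : 'rV[R]_d) : Prop :=
  (forall i, 0 < m 0 i) /\
  exists2 P : 'M[R]_d, P *m P^T = 1%:M &
    invmx (mxsqrt H) *m G *m invmx (mxsqrt H) = P^T *m diag_mx m *m P.

Lemma ex_relative_spectrum (R : realType) (d : nat) (H G : 'M[R]_d) :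
  spd H -> spd G -> exists m, relative_spectrum H G m.
Proof.
move=> spdH spdG; have [symS SS Sunit] := mxsqrtP spdH.
have [|P [m [PP ME m_gt0]]] :=
  @spd_spectral _ _ (invmx (mxsqrt H) *m G *m invmx (mxsqrt H)).
  rewrite -{1}symS -trmx_inv; apply: spd_congruence => //.
  by rewrite unitmx_inv.
by exists m; split=> //; exists P.
Qed.

Lemma relative_spectrum_scale (R : realType) (d : nat) (H G : 'M[R]_d) m (c : R) :
  0 < c -> relative_spectrum H G m -> relative_spectrum H (c *: G) (c *: m).
Proof.
move=> c_gt0 [m_gt0 [P PP ME]]; split=> [i|]; first by rewrite mxE mulr_gt0.
exists P => //; rewrite -scalemxAr -scalemxAl ME linearZ /=.
by rewrite -scalemxAr -scalemxAl.
Qed.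

Lemma relative_spectrum_diag (R : realType) (d : nat) (m : 'rV[R]_d) :
  (forall i, 0 < m 0 i) -> relative_spectrum 1%:M (diag_mx m) m.
Proof.
move=> m_gt0; split=> //; exists 1%:M; first by rewrite trmx1 mulmx1.
have -> : mxsqrt (1%:M : 'M[R]_d) = 1%:M.
  have I1 : (1%:M : 'M[R]_d) *m 1%:M^T = 1%:M by rewrite trmx1 mulmx1.
  have := mxfun_spectral Num.sqrt (const_mx 1) I1.
  rewrite map_const_mx sqrtr1 diag_const_mx trmx1 !mulmx1.
  by [].
by rewrite invmx1 trmx1 !mul1mx.
Qed.

Lemma dAI_spectrum (R : realType) (d : nat) (H G : 'M[R]_d) m :
  relative_spectrum H G m -> dAI H G = Num.sqrt (\sum_i ln (m 0 i) ^+ 2).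
Proof.
case=> _ [P PP ME]; rewrite /dAI /mxlog ME mxfun_spectral //.
rewrite frobenius_spectral //; congr Num.sqrt.
by apply: eq_bigr => i _; rewrite mxE.
Qed.

(** With S = H^1/2 and w = P S v, the equation H v = l G v becomes
    w = l diag(m) w. *)
Lemma gen_eigenvalues_spectrum (R : realType) (d : nat) (H G : 'M[R]_d) m :
  spd H -> relative_spectrum H G m ->
  gen_eigenvalues G H = [set (m 0 i)^-1 | i in setT].
Proof.
move=> spdH [m_gt0 [P PP ME]]; have [symS SS Sunit] := mxsqrtP spdH.
set S := mxsqrt H in symS SS Sunit ME.
have PP' : P^T *m P = 1%:M by apply: mulmx1C.
have Gfact : G = S *m P^T *m diag_mx m *m P *m S.
  have := congr1 (fun X => S *m X *m S) ME.
  by rewrite !mulmxA mulmxV // mul1mx mulmxKV.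
have eigE l v : H *m v = l *: (G *m v) <->
    P *m S *m v = l *: (diag_mx m *m (P *m S *m v)).
  rewrite -SS Gfact; split=> e.
    have := congr1 (fun X => P *m (invmx S *m X)) e.
    by rewrite -!scalemxAr !mulmxA mulmxKV // => ->; rewrite PP mul1mx.
  have := congr1 (fun X => S *m (P^T *m X)) e.
  by rewrite -!scalemxAr !mulmxA -(mulmxA S) PP' mulmx1.
apply/seteqP; split=> l.
  case=> v v0 /eigE; set w := P *m S *m v => wE.
  have w0 : w != 0.
    apply: contra v0 => /eqP w0; have : invmx S *m (P^T *m w) = 0.
      by rewrite w0 !mulmx0.
    by rewrite /w !mulmxA -(mulmxA _ P^T) PP' mulmx1 mulVmx // mul1mx => ->.
  clearbody w; have /cV0Pn[i wi] := w0.
  exists i => //; move/colP/(_ i): wE; rewrite mul_diag_mx !mxE mulrA.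
  move=> e; have : l * m 0 i = 1.
    by apply: (mulIf wi); rewrite mul1r -e.
  by move=> lm; apply/esym/(mulIf (lt0r_neq0 (m_gt0 i))); rewrite lm mulVf ?lt0r_neq0.
move=> [i _ <-]; pose w : 'cV[R]_d := delta_mx i 0.
exists (invmx S *m (P^T *m w)).
  apply/eqP => v0; have : P *m S *m (invmx S *m (P^T *m w)) = 0 by rewrite v0 mulmx0.
  rewrite !mulmxA mulmxK // PP mul1mx => /matrixP/(_ i 0)/eqP.
  by rewrite !mxE !eqxx oner_eq0.
apply/eigE; have -> : P *m S *m (invmx S *m (P^T *m w)) = w.
  by rewrite !mulmxA mulmxK // PP mul1mx.
apply/matrixP => j k; rewrite ord1 mul_diag_mx !mxE eqxx andbT.
case: eqP => [->|_]; last by rewrite !mulr0.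
by rewrite mulr1 mulVf // lt0r_neq0.
Qed.

Lemma kappa_spectrum (R : realType) (d : nat) (H G : 'M[R]_d) m (i0 i1 : 'I_d) :
  spd H -> relative_spectrum H G m ->
  (forall i, m 0 i0 <= m 0 i <= m 0 i1) -> kappa G H = m 0 i1 / m 0 i0.
Proof.
move=> spdH specm extr; rewrite /kappa (gen_eigenvalues_spectrum spdH specm).
have m_gt0 := specm.1.
have upper : ubound [set (m 0 i)^-1 | i in setT] (m 0 i0)^-1.
  by move=> _ [i _ <-]; rewrite lef_pV2 ?posrE //; case/andP: (extr i).
have lower : lbound [set (m 0 i)^-1 | i in setT] (m 0 i1)^-1.
  by move=> _ [i _ <-]; rewrite lef_pV2 ?posrE //; case/andP: (extr i).
have -> : sup [set (m 0 i)^-1 | i in setT] = (m 0 i0)^-1.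
  apply/le_anti/andP; split; first by apply: ge_sup => //; exists (m 0 i0)^-1, i0.
  by apply: ub_le_sup; [exists (m 0 i0)^-1 | exists i0].
have -> : inf [set (m 0 i)^-1 | i in setT] = (m 0 i1)^-1.
  apply/le_anti/andP; split; first by apply: ge_inf; [exists (m 0 i1)^-1 | exists i1].
  by apply: lb_le_inf => //; exists (m 0 i1)^-1, i1.
by rewrite invrK mulrC.
Qed.

(** * Optimal rescaling and the extremal family *)

Lemma quarter_sqr_gt0 (d : nat) : (2 <= d)%N -> (0 < d ^ 2 %/ 4)%N.
Proof. by move=> hd; rewrite divn_gt0 // (@leq_exp2r 2 d 2). Qed.

Lemma dAI_scale_spread (R : realType) (d : nat) (H G : 'M[R]_d) m (c : R) :
  (0 < d)%N -> 0 < c -> relative_spectrum H G m ->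
  let x i := ln (m 0 i) in
  dAI H (c *: G) =
    Num.sqrt ((spread x + (d%:R * ln c + \sum_i x i) ^+ 2) / d%:R).
Proof.
move=> d_gt0 c_gt0 specm x.
rewrite (dAI_spectrum (relative_spectrum_scale c_gt0 specm)) -spread_shift.
rewrite mulrC mulKf ?pnatr_eq0 -?lt0n //; congr Num.sqrt.
by apply: eq_bigr => i _; rewrite mxE lnM ?posrE //; apply: specm.1.
Qed.

(** The optimal [c] centres the logarithms of the relative spectrum, after which
    [spread_le] applies with [r] their range, that is [ln (kappa G H)]. *)
Lemma alpha_dAI_le_ln_kappa (R : realType) (d : nat) (H G : 'M[R]_d) :
  (2 <= d)%N -> spd H -> spd G ->
  0 < kappa G H /\
  exists2 c, 0 < c & alpha R d * dAI H (c *: G) <= ln (kappa G H).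
Proof.
case: d H G => // d H G hd spdH spdG.
have [m specm] := ex_relative_spectrum spdH spdG; have m_gt0 := specm.1.
case: (arg_minP (m 0) (i0 := ord0) (P := predT)) => // i0 _ min_i0.
case: (arg_maxP (m 0) (i0 := ord0) (P := predT)) => // i1 _ max_i1.
have extr i : m 0 i0 <= m 0 i <= m 0 i1.
  by apply/andP; split; [apply: min_i0 | apply: max_i1].
rewrite (kappa_spectrum spdH specm extr); split; first exact: divr_gt0.
pose x i := ln (m 0 i).
pose mu := (\sum_i x i) / d.+1%:R; exists (expR (- mu)); first exact: expR_gt0.
rewrite (dAI_scale_spread _ (expR_gt0 _) specm) // expRK -/x.
have -> : d.+1%:R * - mu + \sum_i x i = 0.
  by rewrite /mu mulrN mulrC divfK ?pnatr_eq0 // addNr.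
have q_gt0 : 0 < (d.+1 ^ 2 %/ 4)%N%:R :> R by rewrite ltr0n quarter_sqr_gt0.
set r := ln _; have r_ge0 : 0 <= r.
  by rewrite ln_ge0 // ler_pdivlMr // mul1r; case/andP: (extr i0).
have xr i j : x i - x j <= r.
  rewrite /r ln_div ?posrE //; case/andP: (extr i) => _ ii; case/andP: (extr j) => jj _.
  by rewrite lerB // ler_ln ?posrE.
rewrite expr0n addr0 /alpha -sqrtrM ?divr_ge0 ?ler0n //.
rewrite -[leRHS](ger0_norm r_ge0) -sqrtr_sqr; apply: ler_wsqrtr.
rewrite mulrC mulrA divfK ?pnatr_eq0 // ler_pdivrMr // mulrC.
exact: spread_le.
Qed.

(** The ray through the diagonal matrix [G] below attains equality: its logarithmic
    spectrum is the balanced two-valued family of [spread_split], with range 1,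
    and no rescaling brings it closer to the identity than centring does. *)
Lemma alpha_sharp (R : realType) (d : nat) (a : R) : (2 <= d)%N ->
  (forall (H : 'M[R]_d) (F : set 'M[R]_d),
      spd H -> scale_family F -> a * deltaAI F H <= ln (Kstar F H)) ->
  a <= alpha R d.
Proof.
case: d => // d hd bound.
have q_gt0 : 0 < (d.+1 ^ 2 %/ 4)%N%:R :> R by rewrite ltr0n quarter_sqr_gt0.
have [a_le0|a_gt0] := leP a 0; first exact: le_trans a_le0 (sqrtr_ge0 _).
have alpha_gt0 : 0 < alpha R d.+1 by rewrite sqrtr_gt0 divr_gt0 // ltr0n.
pose x (i : 'I_d.+1) : R := (i < d.+1./2)%N%:R.
pose D := \row_i expR (x i); pose G := diag_mx D.
have D_gt0 i : 0 < D 0 i by rewrite mxE expR_gt0.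
have spdG : spd G by apply/spd_diag.
have spd1 : spd (1%:M : 'M[R]_d.+1).
  by rewrite -diag_const_mx; apply/spd_diag => i; rewrite mxE ltr01.
have specD : relative_spectrum 1%:M G D by apply: relative_spectrum_diag.
pose F := [set c *: G | c in [set c : R | 0 < c]].
have famF : scale_family F.
  split=> [_ [c c_gt0 <-]||_ b [c c_gt0 <-] b_gt0]; first exact: spd_scale.
    by exists (1 *: G), 1 => //=; apply: ltr01.
  by exists (b * c); rewrite ?scalerA //=; apply: mulr_gt0.
have in_first : (0 < uphalf d)%N by lia.
have out_last : (d < uphalf d)%N = false by lia.
have kappaF c : 0 < c -> kappa (c *: G) 1%:M = expR 1.
  move=> c_gt0.
  rewrite (kappa_spectrum (i0 := ord_max) (i1 := ord0) spd1
             (relative_spectrum_scale c_gt0 specD)).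
    rewrite !mxE /x /=.
    by rewrite out_last in_first expR0 mulr1 mulrC mulKf ?gt_eqF.
  move=> i; rewrite !mxE !ler_pM2l // !ler_expR /x !ler_nat.
  by rewrite /= out_last in_first leq_b1.
have KE : Kstar F 1%:M = expR 1.
  rewrite /Kstar; have -> : [set kappa K 1%:M | K in F] = [set expR 1].
    apply/seteqP; split=> [_ [_ [c c_gt0 <-] <-]|_ ->]; first exact: kappaF.
    by exists (1 *: G); [exists 1 => //=; apply: ltr01 | rewrite kappaF].
  by rewrite inf1.
have dist : (alpha R d.+1)^-1 <= deltaAI F 1%:M.
  apply: lb_le_inf.
    by exists (dAI 1%:M (1 *: G)), (1 *: G) => //; exists 1 => //=; apply: ltr01.
  move=> _ [_ [c c_gt0 <-] <-]; rewrite (dAI_scale_spread _ c_gt0 specD) //.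
  rewrite /alpha -sqrtrV ?divr_ge0 ?ler0n // invf_div; apply: ler_wsqrtr.
  rewrite ler_wpM2r ?invr_ge0 ?ler0n // -(spread_split R d.+1).
  have -> : (fun i => ln (D 0 i)) = x by apply/funext => i; rewrite mxE expRK.
  by rewrite lerDl sqr_ge0.
have := bound _ _ spd1 famF; rewrite KE expRK => bnd.
rewrite -[leRHS]mul1r -ler_pdivrMr //; apply: le_trans bnd.
by rewrite ler_wpM2l // ltW.
Qed.

Theorem corollary3p7 (R : realType) (d : nat) (hd : (2 <= d)%N) :
  (forall (H : 'M[R]_d) (F : set 'M[R]_d),
      spd H -> scale_family F ->
      alpha R d * deltaAI F H <= ln (Kstar F H) /\
      expR (alpha R d * deltaAI F H) <= Kstar F H) /\
  (forall a : R,
      (forall (H : 'M[R]_d) (F : set 'M[R]_d),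
          spd H -> scale_family F -> a * deltaAI F H <= ln (Kstar F H)) ->
      a <= alpha R d).
Proof.
split=> [H F spdH [spdF [G0 FG0] scaleF]|a]; last exact: alpha_sharp.
have exp_le : expR (alpha R d * deltaAI F H) <= Kstar F H.
  apply: lb_le_inf => [|_ [G FG <-]]; first by exists (kappa G0 H), G0.
  have [kappa_gt0 [c c_gt0 le_kappa]] := alpha_dAI_le_ln_kappa hd spdH (spdF _ FG).
  rewrite -[leRHS]lnK ?posrE // ler_expR; apply: le_trans le_kappa.
  rewrite ler_wpM2l ?sqrtr_ge0 //; apply: ge_inf.
    by exists 0 => _ [K _ <-]; apply: sqrtr_ge0.
  by exists (c *: G) => //; apply: scaleF.
split=> //; rewrite -[leLHS]expRK ler_ln ?posrE ?expR_gt0 //.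
exact: lt_le_trans (expR_gt0 _) exp_le.
Qed.
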